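(* Let $A$ be an $n\times n$ primitive real matrix with positive trace. The collection of positive $n\times n$ matrices similar over $\mathbb{R}$ to $A$ contains only finitely many SSE$-\mathbb{R}_+$ classes; that is, this collection meets only finitely many equivalence classes of the relation SSE$-\mathbb{R}_+$.
   Context: A matrix is nonnegative (resp. positive) if all its entries are $\ge 0$ (resp. $>0$). A matrix $A$ is primitive if it is nonnegative, square, and there is some $r\in\mathbb{N}$ such that $A^r$ is positive. $\mathbb{R}_+$ is the semiring of nonnegative real numbers. Square matrices $A,B$ over $\mathbb{R}_+$ (possibly of different sizes) are elementary strong shift equivalent over $\mathbb{R}_+$ (ESSE$-\mathbb{R}_+$) if there exist (possibly rectangular) matrices $U,V$ over $\mathbb{R}_+$ with $A=UV$, $B=VU$. They are strong shift equivalent over $\mathbb{R}_+$ (SSE$-\mathbb{R}_+$) if there is a finite sequence of square matrices $A=A_0,A_1,\ldots,A_l=B$ over $\mathbb{R}_+$ (of possibly varying sizes) with $A_i$ ESSE$-\mathbb{R}_+$ to $A_{i+1}$ for all $0\le i<l$. SSE$-\mathbb{R}_+$ is an equivalence relation. *)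

(* Defs.v *)
(* The real numbers are an arbitrary [R : realType]; matrices over the semiring
   R_+ are encoded as real matrices all of whose entries are nonnegative. *)
From mathcomp Require Import all_boot all_order all_algebra.
From mathcomp Require Import classical_sets cardinality reals.

Set Implicit Arguments.
Unset Strict Implicit.
Unset Printing Implicit Defensive.

Import Order.TTheory GRing.Theory Num.Theory.
Local Open Scope ring_scope.
Local Open Scope classical_set_scope.

Section MatrixPredicates.
Variable R : numDomainType.

Definition nonneg_mx m n (A : 'M[R]_(m, n)) : Prop :=
  A \is a mxOver Num.nneg.

Definition pos_mx m n (A : 'M[R]_(m, n)) : Prop :=
  A \is a mxOver Num.pos.

(* The exponent is taken to be positive; allowing r = 0 would only add the zero
   matrix in size 1 and the empty matrix. *)
Definition primitive_mx n (A : 'M[R]_n) : Prop :=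
  nonneg_mx A /\ exists2 r : nat, (0 < r)%N & pos_mx (A ^+ r).

End MatrixPredicates.

Section StrongShiftEquivalence.
Variable R : realType.

(* Square matrices of arbitrary size >= 1; [Tagged _ A : sqmx R] regards
   A : 'M[R]_n.+1 as such a matrix. *)
Definition sqmx : Type := {n : nat & 'M[R]_n.+1}.

Definition nonneg_sqmx (A : sqmx) : Prop := nonneg_mx (tagged A).

Definition ESSE (A B : sqmx) : Prop :=
  exists (U : 'M[R]_((tag A).+1, (tag B).+1))
         (V : 'M[R]_((tag B).+1, (tag A).+1)),
    [/\ nonneg_mx U, nonneg_mx V, tagged A = U *m V & tagged B = V *m U].

Definition SSE (A B : sqmx) : Prop :=
  exists (l : nat) (C : nat -> sqmx),
    [/\ C 0%N = A, C l = B,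
        forall i, (i <= l)%N -> nonneg_sqmx (C i)
      & forall i, (i < l)%N -> ESSE (C i) (C i.+1)].

Definition SSE_class (A : sqmx) : set sqmx := [set B | SSE A B].

End StrongShiftEquivalence.

(* Main.v *)
(* The positive matrices similar to A are the G^-1 A G with G in the open
   semialgebraic set of invertible G for which G^-1 A G is positive.

   Locally the SSE class does not depend on G: moving one entry of G replaces
   B = G^-1 A G by H^-1 B H with H = I + s g e_j^T. For small s, H = U V^-1 with
   U and V nonnegative, equal to the identity outside column j and close to it,
   so U^-1 B and U^-1 B H are still nonnegative and B = U (U^-1 B),
   H^-1 B H = V (U^-1 B H) give two elementary equivalences.

   It remains that a function c which is locally constant on the complement of a
   hypersurface p <> 0 of R^n takes finitely many values there. By induction on
   the number of variables: replace p by a polynomial q in the last variable with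
   only simple roots as long as a nonzero polynomial D in the other variables does
   not vanish. Then the set of values of c on the fiber { q(x, .) <> 0 } is finite
   and locally constant in x on { D <> 0 }, as simple roots neither split nor
   collide; and every point with p <> 0 can be moved into { D q <> 0 } without
   changing c. *)
Require Import Defs.
From mathcomp Require Import all_boot all_order all_algebra.
From mathcomp Require Import classical_sets cardinality reals.
From mathcomp Require Import boolp functions filter topology normedtype.
From mathcomp Require Import separable polyrcf ring.

Set Implicit Arguments.
Unset Strict Implicit.
Unset Printing Implicit Defensive.

Import Order.TTheory GRing.Theory Num.Theory.
Import numFieldNormedType.Exports.
Local Open Scope ring_scope.
Local Open Scope classical_set_scope.

(** The supremum of the [v] in [[a, b]] with [P a v] must be [b]: the local hypothesis at a smaller
    supremum, composed by [Ptrans], would reach beyond it. *)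
Lemma interval_induction (R : realType) (P : R -> R -> Prop) (a b : R) : a <= b ->
    (forall u v w, u <= v -> v <= w -> P u v -> P v w -> P u w) ->
    (forall s, a <= s <= b -> exists2 e, 0 < e & forall u v,
       a <= u -> v <= b -> s - e < u -> u <= s -> s <= v -> v < s + e -> P u v) ->
  P a b.
Proof.
move=> leab Ptrans Ploc.
pose E := [set v | a <= v <= b /\ P a v].
have Ea : E a.
  split; first by rewrite lexx.
  have [|e e0 Pe] := Ploc a; first by rewrite lexx.
  by apply: Pe => //; rewrite ?ltrDl ?ltrBlDr ?ltrDl.
have supE : has_sup E by split; [exists a | exists b => v [/andP[]]].
have ubE v : E v -> v <= sup E by move=> Ev; exact: (sup_upper_bound supE).
have ac : a <= sup E by apply: ubE.
have cb : sup E <= b by apply: ge_sup; [exists a | move=> v [/andP[]]].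
have [|e e0 Pe] := Ploc (sup E); first by rewrite ac.
have [v [/andP[av vb] Pav] vlt] := sup_adherent e0 supE.
have vc : v <= sup E by apply: ubE; split; rewrite ?av.
pose w := Num.min b (sup E + e / 2).
have cw : sup E <= w by rewrite le_min cb lerDl divr_ge0 ?ltW.
have wb : w <= b by rewrite ge_min lexx.
have Paw : P a w.
  apply: (Ptrans a v w) => //; first exact: le_trans vc cw.
  apply: Pe => //; apply: (@le_lt_trans _ _ (sup E + e / 2)).
    by rewrite ge_min lexx orbT.
  by rewrite ltrD2l ltr_pdivrMr ?ltr_pMr // ltr1n.
have Ew : E w by split; rewrite ?wb ?(le_trans ac cw).
have : w <= sup E by exact: ubE.
rewrite /w ge_min => /orP[bc|]; last by rewrite gerDl leNgt divr_gt0.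
by have <- : w = b by apply/le_anti; rewrite wb (le_trans bc cw).
Qed.

(** * Square-free part of a polynomial over a domain of characteristic zero *)

Section SquareFree.
Variable K : idomainType.
Implicit Types p q g : {poly K}.

(** Differentiate the relation for [k] and multiply by [q]: every term but the one sought is a
    multiple of [g]. When [k] is the degree of [g], the derivative is a nonzero constant, so [g]
    divides a power of [q]. *)
Lemma dvdp_derivn_exp g q k : g %| q * g^`() -> g %| g^`(k) * q ^+ k.
Proof.
move=> dv; elim: k => [|k IHk]; first by rewrite expr0 mulr1 derivn0.
have /Pdiv.Idomain.dvdpP[[c w] /= c0 Ew] := IHk.
have := congr1 (fun f => f^`() * q) Ew.
rewrite derivZ !derivM -derivnS deriv_exp -scalerAl => Eq.
have Eqk : q^`() * q ^+ k.-1 *+ k * q = q ^+ k * q^`() *+ k.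
  by case: (k) => [|j] /=; rewrite ?mulr0n ?mul0r // exprS; ring.
rewrite -(dvdpZr _ _ c0).
have -> : c *: (g^`(k.+1) * q ^+ k.+1) =
    (w^`() * q) * g + w * (q * g^`()) - (c *: (q^`() *+ k)) * (g^`(k) * q ^+ k).
  have -> : (w^`() * q) * g + w * (q * g^`()) = (w^`() * g + w * g^`()) * q by ring.
  rewrite -Eq mulrDl -!(mulrA _ _ q) Eqk -exprSr -!scalerAl -scalerBr.
  by congr (_ *: _); ring.
by rewrite dvdp_sub ?dvdp_add // dvdp_mull ?dvdpp.
Qed.

Hypothesis char0 : forall n, n.+1%:R != 0 :> K.

Lemma derivn_size_pred g : g != 0 -> exists2 c, c != 0 & g^`((size g).-1) = c%:P.
Proof.
move=> g0; exists (lead_coef g *+ (size g).-1`!).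
  rewrite -mulr_natr mulf_neq0 ?lead_coef_eq0 //.
  by have := fact_gt0 (size g).-1; case: (_`!).
apply/polyP => i; rewrite coef_derivn coefC; case: i => [|i] /=.
  by rewrite addn0 ffactnn.
by rewrite nth_default ?mul0rn // addnS -addSn (leq_trans (leqSpred _)) ?leq_addr.
Qed.

(** The scalar [D] comes from pseudo-division and Bezout. As polynomial identities, both equations
    survive specialisation of the coefficients: wherever [D] stays nonzero, roots of [p] are roots
    of [q], and those are simple. *)
Lemma separable_radical p : p != 0 -> exists q (k : nat) (D : K) (w u v : {poly K}),
  [/\ q != 0, D != 0, D *: q ^+ k = w * p & u * q + v * q^`() = D%:P].
Proof.
move=> p0; set g := gcdp p p^`(); set q := p %/ g.
have sepq : separable_poly q by exact: make_separable.
have q0 : q != 0 by exact: separable_poly_neq0.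
have gp : g %| p by exact: dvdp_gcdl.
have g0 : g != 0 by rewrite gcdp_eq0 negb_and p0.
have Dp := Pdiv.Idomain.divpK gp; rewrite -/q in Dp.
have lg0 : lead_coef g ^+ scalp p g != 0 by rewrite expf_neq0 ?lead_coef_eq0.
have gq : g %| q * g^`().
  have : g %| (q * g)^`() by rewrite Dp derivZ dvdpZr // dvdp_gcdr.
  by rewrite derivM dvdp_addr // dvdp_mull.
(* Up to a scalar, [p] is [q * g]: one factor [q] covers the first, and the other [(size g).-1], the
   degree of [g], cover [g]. *)
have pq : p %| q ^+ (size g).
  rewrite -(dvdpZl _ _ lg0) -Dp -(ltn_predK (m := 0) (n := size g)) ?size_poly_gt0 //.
  rewrite exprS dvdp_mul2l //.
  have := dvdp_derivn_exp (size g).-1 gq.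
  by have [c c0 ->] := derivn_size_pred g0; rewrite mul_polyC dvdpZr.
have /Pdiv.Idomain.dvdpP[[c w] /= c0 Ew] := pq.
have : coprimep q q^`() by move: sepq; rewrite unlock.
move/Bezout_coprimepP => [[u v] /= /eqpP[[d e] /= /andP[d0 e0] Euv]].
exists q, (size g), (c * e), (e *: w), (c *: (d *: u)), (c *: (d *: v)).
split=> //; first exact: mulf_neq0.
  by rewrite mulrC -scalerA Ew scalerAl.
by rewrite -!scalerAl -!scalerDr Euv alg_polyC polyCM mul_polyC.
Qed.

End SquareFree.

(** * Polynomials in finitely many variables and their evaluation *)

(* Iterated univariate polynomials, the last variable being outermost;
   [ev x n] only reads [x 0], ..., [x n.-1]. *)
Fixpoint mpol (K : idomainType) (n : nat) : idomainType :=
  if n is m.+1 then ({poly mpol K m} : idomainType) else K.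

Fixpoint ev (K : idomainType) (x : nat -> K) (n : nat) : {rmorphism mpol K n -> K} :=
  if n is m.+1 return {rmorphism mpol K n -> K}
  then horner_eval (x m) \o map_poly (ev x m) : {rmorphism {poly mpol K m} -> K}
  else idfun.

Definition upd (T : Type) (x : nat -> T) (i : nat) (t : T) : nat -> T :=
  fun j => if j == i then t else x j.

Section Eval.
Variable K : idomainType.
Implicit Types (x y : nat -> K) (n : nat).

Lemma evS x n (p : {poly mpol K n}) :
  ev x n.+1 p = (map_poly (ev x n) p).[x n].
Proof. by []. Qed.

Lemma eq_ev x y n (p : mpol K n) :
  (forall k, (k < n)%N -> x k = y k) -> ev x n p = ev y n p.
Proof.
elim: n p => [//|n IHn] p exy; rewrite !evS exy //; congr (_.[_]).
by apply: eq_map_poly => c; apply: IHn => k kn; apply: exy; apply: leqW.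
Qed.

Lemma upd_out x i t n k : (n <= i)%N -> (k < n)%N -> upd x i t k = x k.
Proof. by move=> ni kn; rewrite /upd ltn_eqF // (leq_trans kn). Qed.

Lemma map_ev_upd x i t n (p : {poly mpol K n}) : (n <= i)%N ->
  map_poly (ev (upd x i t) n) p = map_poly (ev x n) p.
Proof. by move=> ni; apply: eq_map_poly => c; apply: eq_ev => k; apply: upd_out. Qed.

Lemma ev_upd x t n (p : {poly mpol K n}) :
  ev (upd x n t) n.+1 p = (map_poly (ev x n) p).[t].
Proof. by rewrite evS map_ev_upd // /upd eqxx. Qed.

Fixpoint mvar n (k : nat) : mpol K n :=
  if n is m.+1 return mpol K n
  then if k == m then 'X : {poly mpol K m} else (mvar m k)%:P else 0.

Lemma ev_mvar x n k : (k < n)%N -> ev x n (mvar n k) = x k.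
Proof.
elim: n => // n IHn; rewrite ltnS leq_eqVlt evS /=.
have [-> _|_ /= /IHn <-] := eqVneq k n; first by rewrite map_polyX hornerX.
by rewrite map_polyC hornerC.
Qed.

Fixpoint mcst n (c : K) : mpol K n :=
  if n is m.+1 return mpol K n then (mcst m c)%:P else c.

Lemma ev_mcst x n c : ev x n (mcst n c) = c.
Proof. by elim: n => // n IHn; rewrite evS /= map_polyC hornerC. Qed.

End Eval.

(** * Continuity of evaluation, and control of roots when one coordinate moves *)

Section Continuity.
Variable R : realType.
Implicit Types (x : nat -> R) (n : nat).

(** The parameter space [T] is arbitrary so that two coordinates can also move at once. *)
Lemma continuous_ev (T : topologicalType) (a : T) (f : T -> nat -> R) n (p : mpol R n) :
  (forall k, {for a, continuous (fun z => f z k)}) ->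
  {for a, continuous (fun z => ev (f z) n p)}.
Proof.
move=> cf; elim: n p => [p|n IHn]; first exact: cvg_cst.
elim/poly_ind => [|p d IHp].
  by rewrite (_ : (fun z => _) = cst 0); [exact: cvg_cst | apply/funext => z; rewrite raddf0].
have -> : (fun z => ev (f z) n.+1 (p * 'X + d%:P)) =
    (fun z => ev (f z) n.+1 p * f z n + ev (f z) n d).
  apply/funext => z.
  by rewrite !evS rmorphD rmorphM /= map_polyX map_polyC hornerMXaddC.
by apply: cvgD; [apply: cvgM; [exact: IHp | exact: cf] | exact: IHn].
Qed.

Lemma upd_id x i : upd x i (x i) = x.
Proof. by apply/funext => k; rewrite /upd; case: eqP => [->|]. Qed.

Lemma continuous_ev_upd x i n (p : mpol R n) :
  (fun s => ev (upd x i s) n p) @ x i --> ev x n p.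
Proof.
rewrite -[X in _ --> ev X n p](upd_id x i); apply: continuous_ev => k.
by rewrite /upd; case: (k == i); [exact: cvg_id | exact: cvg_cst].
Qed.

Lemma near_ev_neq0 x i n (p : mpol R n) :
  ev x n p != 0 -> \forall s \near x i, ev (upd x i s) n p != 0.
Proof.
move=> px0.
have FF := nbhs_filter (x i).
exact: (@cvgr_neq0 _ R^o _ _ FF _ (ev x n p) (@continuous_ev_upd x i n p) px0).
Qed.

(** Joint continuity in [s] and [t] gives a radius [e] independent of [s]. *)
Lemma near_horner_neq0 x i n (p : {poly mpol R n}) t0 :
  (map_poly (ev x n) p).[t0] != 0 -> exists2 e, 0 < e &
    \forall s \near x i, forall t, `|t0 - t| < e ->
      (map_poly (ev (upd x i s) n) p).[t] != 0.
Proof.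
move=> pt0; pose f (z : R * R) := upd (upd x i z.1) n z.2.
have cf : {for (x i, t0), continuous (fun z => ev (f z) n.+1 p)}.
  apply: continuous_ev => k; rewrite /f /upd.
  case: (k == n); first exact: cvg_snd.
  by case: (k == i); [exact: cvg_fst | exact: cvg_cst].
have : \forall z \near (x i, t0), ev (f z) n.+1 p != 0.
  have FF := nbhs_filter (x i, t0); apply: (@cvgr_neq0 _ R^o _ _ FF _ _ cf).
  by have -> : f (x i, t0) = upd x n t0; [rewrite /f /= upd_id | rewrite ev_upd].
case=> -[A B] /= [nA /nbhs_ballP[e e0 eB]] AB; exists e => //.
apply: filterS nA => s As t te; rewrite -ev_upd.
by apply: (AB (s, t)); split=> //=; apply: eB.
Qed.

(** Cauchy's root bound is continuous in the coefficients while the leading one is nonzero. [M] is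
    this bound at [x], with the inverse of the leading coefficient and each coefficient size
    enlarged by one to leave room for [s]. *)
Lemma near_no_large_root x i n (p : {poly mpol R n}) :
  ev x n (lead_coef p) != 0 -> exists2 M, 0 <= M &
    \forall s \near x i, forall t, M <= `|t| ->
      (map_poly (ev (upd x i s) n) p).[t] != 0.
Proof.
move=> lp0; have p0 : p != 0 by apply: contraNneq lp0 => ->; rewrite lead_coef0 raddf0.
set a := ev x n.
have FF := nbhs_filter (x i).
exists (1 + (`|a (lead_coef p)|^-1 + 1) * \sum_(k < size p) (`|a p`_k| + 1)).
  by rewrite addr_ge0 ?mulr_ge0 ?addr_ge0 ?invr_ge0 ?sumr_ge0 // => k _; rewrite addr_ge0.
have near_lead : \forall s \near x i, `|ev (upd x i s) n (lead_coef p)|^-1 < `|a (lead_coef p)|^-1 + 1.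
  apply: (@cvgr_lt _ _ _ FF _ `|a (lead_coef p)|^-1); last by rewrite ltrDl.
  apply: cvgV; rewrite ?normr_eq0 //; apply: cvg_norm; exact: continuous_ev_upd.
have near_coef : \forall s \near x i, forall k : 'I_(size p),
    `|ev (upd x i s) n p`_k| < `|a p`_k| + 1.
  apply: (filter_forall (F := nbhs (x i))) => k.
  apply: (@cvgr_lt _ _ _ FF _ `|a p`_k|); last by rewrite ltrDl.
  apply: cvg_norm; exact: continuous_ev_upd.
near=> s => t; apply: contraTneq => pt0.
have lps0 : ev (upd x i s) n (lead_coef p) != 0 by near: s; exact: near_ev_neq0.
have szp : size (map_poly (ev (upd x i s) n) p) = size p by rewrite size_map_poly_id0.
rewrite -ltNge; apply: (lt_le_trans (cauchy_boundP _ pt0)).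
  by rewrite -size_poly_gt0 szp size_poly_gt0.
rewrite /cauchy_bound lerD2l ler_pM ?invr_ge0 ?sumr_ge0 //.
  by rewrite lead_coef_map_id0 ?rmorph0 // ltW //; near: s.
rewrite szp ler_sum // => k _; rewrite coef_map ltW //.
by move: k; near: s.
Unshelve. all: by end_near. Qed.

End Continuity.

Lemma poly_nonroot_between (R : realFieldType) (p : {poly R}) (a b : R) :
  p != 0 -> a < b -> exists2 t, a < t < b & p.[t] != 0.
Proof.
move=> p0 ab; apply: contrapT => nt.
(* Denominators start at 2 to stay strictly below [b]; [size p] such points are one too many to be
   roots. *)
pose f (k : nat) := a + (b - a) / k.+2%:R.
have finj : injective f.
  move=> j k /addrI /(mulfI _); rewrite subr_eq0 gt_eqF // => /(_ isT) /invr_inj /eqP.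
  by rewrite eqr_nat => /eqP[].
have := @max_poly_roots _ p (map f (iota 0 (size p))) p0.
rewrite map_inj_uniq // iota_uniq size_map size_iota ltnn => H.
suff : false by []; apply: H => //; apply/allP => _ /mapP[k _ ->].
apply/negPn/negP => fk; apply: nt; exists (f k) => //.
rewrite ltrDl divr_gt0 ?subr_gt0 //= -ltrBrDl ltr_pdivrMr // ltr_pMr ?subr_gt0 //.
by rewrite ltr1n.
Qed.

(** * Locally constant functions of finitely many real coordinates *)

Section LocallyConstant.
Variables (R : realType) (T : Type).
Implicit Types (x y : nat -> R) (n i : nat) (c : (nat -> R) -> T).

Definition depends_on_first c n :=
  forall x y, (forall k, (k < n)%N -> x k = y k) -> c x = c y.

(** Constancy is only asked along each coordinate line, which matches moving a single entry of a
    matrix. *)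
Definition loc_cst_on c (U : set (nat -> R)) :=
  forall x, U x -> forall i, \forall s \near x i, c (upd x i s) = c x.

(** By induction the first coordinates can be moved until the leading coefficient is nonzero; a
    small move of the last coordinate then avoids the finitely many roots. *)
Lemma loc_cst_nonroot c (U : set (nat -> R)) n (p : mpol R n) x :
    loc_cst_on c U ->
    (forall y, U y -> forall i, \forall s \near y i, U (upd y i s)) ->
    p != 0 -> U x ->
  exists y, [/\ U y, ev y n p != 0 & c y = c x].
Proof.
move=> lc openU; elim: n p => [|n IHn] p p0 Ux; first by exists x.
have [|y [Uy lpy cyx]] := IHn (lead_coef (p : {poly mpol R n})) _ Ux.
  by rewrite lead_coef_eq0.
have [e e0 eP] : exists2 e, 0 < e & forall s, `|y n - s| < e ->
    U (upd y n s) /\ c (upd y n s) = c y.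
  have /nbhs_ballP[e e0 eP] : \forall s \near y n, U (upd y n s) /\ c (upd y n s) = c y.
    by near=> s; split; near: s; [exact: openU | exact: lc].
  by exists e.
have py0 : map_poly (ev y n) (p : {poly mpol R n}) != 0.
  by rewrite -lead_coef_eq0 lead_coef_map_id0 ?rmorph0.
have [|t /andP[lt gt] pt] := @poly_nonroot_between _ _ (y n) (y n + e) py0.
  by rewrite ltrDl.
have [|Ut ct] := eP t; first by rewrite distrC gtr0_norm ?subr_gt0 // ltrBlDl.
by exists (upd y n t); rewrite ev_upd ct.
Unshelve. all: by end_near. Qed.

End LocallyConstant.

(** * Values of the function along a fiber, the line of the last variable *)

Section Fiber.
Variables (R : realType) (T : Type) (n : nat).
Variables (c : (nat -> R) -> T) (D : mpol R n) (q : {poly mpol R n}).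
Let Q x := map_poly (ev x n) q.
Hypothesis c_dep : depends_on_first c n.+1.
Hypothesis c_loc :
  loc_cst_on c [set x | ev x n D != 0 /\ ev x n.+1 q != 0].
Hypothesis lead_q : forall x, ev x n D != 0 -> ev x n (lead_coef q) != 0.
Hypothesis simple_q : forall x t, ev x n D != 0 -> (Q x).[t] != 0 \/ (Q x)^`().[t] != 0.
Implicit Types (x y : nat -> R) (i : nat).

Let D_upd x t : ev (upd x n t) n D = ev x n D.
Proof. by apply: eq_ev => k; apply: upd_out. Qed.

Let upd_upd x s t : c (upd (upd x n s) n t) = c (upd x n t).
Proof. by apply: c_dep => k _; rewrite /upd; case: eqP. Qed.

Lemma c_horizontal x a b : ev x n D != 0 -> a <= b ->
    (forall t, a <= t <= b -> (Q x).[t] != 0) ->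
  c (upd x n a) = c (upd x n b).
Proof.
move=> Dx ab Qn0.
apply: (@interval_induction _ (fun u v => c (upd x n u) = c (upd x n v))) => // [u v w _ _ -> //|s abs].
have /nbhs_ballP[e /= e0 eP] : \forall t \near s, c (upd x n t) = c (upd x n s).
  have := @c_loc (upd x n s) _ n; rewrite {2}/upd eqxx => H.
  near=> t; rewrite -(upd_upd x s t); near: t; apply: H.
  by split; rewrite ?D_upd // ev_upd Qn0.
exists e => // u v _ _ su us sv vs.
have Hball t : s - e < t -> t < s + e -> c (upd x n t) = c (upd x n s).
  by move=> h1 h2; apply: eP; rewrite /ball /= ltr_distlC h1 h2.
rewrite (Hball u) ?(Hball v) //; first exact: lt_le_trans (lt_le_trans su us) sv.
by apply: (le_lt_trans us); rewrite ltrDl.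
Unshelve. all: by end_near. Qed.

Lemma c_vertical x i t : i != n -> ev x n D != 0 -> (Q x).[t] != 0 ->
  \forall s \near x i, c (upd (upd x i s) n t) = c (upd x n t).
Proof.
move=> ni Dx Qt; have := @c_loc (upd x n t) _ i.
rewrite {2}/upd (negPf ni) => H; near=> s.
have -> : c (upd (upd x i s) n t) = c (upd (upd x n t) i s).
  by apply: c_dep => k _; rewrite /upd; case: eqP => // ->; rewrite eq_sym (negPf ni).
by near: s; apply: H; split; rewrite ?D_upd // ev_upd.
Unshelve. all: by end_near. Qed.

(** The list [L] lives in the fiber over [x], need not lie in [[u, v]], and serves all nearby [s]
    and all [t] uniformly. *)
Let covered x i (u v : R) := exists L : seq R,
  (forall l, l \in L -> (Q x).[l] != 0) /\
  \forall s \near x i, forall t, u <= t <= v -> (Q (upd x i s)).[t] != 0 ->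
    exists2 l, l \in L & c (upd (upd x i s) n t) = c (upd x n l).

(* As roots are simple, Rolle leaves room for at most one root in a small
   interval, so every point is joined inside its fiber to an endpoint. *)
Lemma covered_local x i t0 : i != n -> ev x n D != 0 ->
  exists2 e, 0 < e & forall u v, t0 - e < u -> u <= t0 -> t0 <= v -> v < t0 + e ->
    covered x i u v.
Proof.
move=> ni Dx.
(* Around [t0], either the polynomial or its derivative has no zero, on one interval valid for all
   nearby [s]. *)
have [d d0 box] : exists2 d, 0 < d & \forall s \near x i,
    (forall t, `|t0 - t| < d -> (Q (upd x i s)).[t] != 0) \/
    (forall t, `|t0 - t| < d -> (Q (upd x i s))^`().[t] != 0).
  case: (simple_q t0 Dx) => [/(near_horner_neq0 i)|].
    by case=> d d0 h; exists d => //; apply: filterS h; left.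
  rewrite deriv_map => /(near_horner_neq0 i)[d d0 h]; exists d => //.
  by apply: filterS h => s hs; right => t td; rewrite deriv_map; apply: hs.
have Q0 : Q x != 0.
  by rewrite -lead_coef_eq0 lead_coef_map_id0 ?rmorph0 ?lead_q.
have [|a /andP[a1 a2] Qa] := @poly_nonroot_between _ _ (t0 - d) t0 Q0.
  by rewrite ltrBlDr ltrDl.
have [|b /andP[b1 b2] Qb] := @poly_nonroot_between _ _ t0 (t0 + d) Q0.
  by rewrite ltrDl.
exists (Num.min (t0 - a) (b - t0)) => [|u v hu ut tv hv].
  by rewrite lt_min !subr_gt0 a2.
have au : a < u.
  apply: le_lt_trans hu; by rewrite lerBrDr -lerBrDl ge_min lexx.
have vb : v < b.
  apply: lt_le_trans hv _; by rewrite -lerBrDl ge_min lexx orbT.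
exists [:: a; b]; split=> [l|]; first by rewrite !inE => /orP[]/eqP->.
have cva := c_vertical ni Dx Qa; have cvb := c_vertical ni Dx Qb.
near=> s => t /andP[ut' tv'] Qt.
have boxs : (forall t, `|t0 - t| < d -> (Q (upd x i s)).[t] != 0) \/
    (forall t, `|t0 - t| < d -> (Q (upd x i s))^`().[t] != 0) by near: s.
have Ds : ev (upd x i s) n D != 0 by near: s; exact: near_ev_neq0.
have inbox w : a <= w -> w <= b -> `|t0 - w| < d.
  move=> aw wb; rewrite ltr_distlC; apply/andP; split.
    exact: lt_le_trans a1 aw.
  exact: le_lt_trans wb b2.
have at_ : a <= t by rewrite ltW // (lt_le_trans au).
have tb : t <= b by rewrite ltW // (le_lt_trans tv').
(* With no root between [a] and [t], [t] is joined to [a]. Otherwise it is joined to [b], since a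
   root between [t] and [b] besides [r1] would contradict [boxs]. *)
have [noroot|[r1 /andP[ar1 r1t] Qr1]] :
    (forall w, a <= w <= t -> (Q (upd x i s)).[w] != 0) \/
    (exists2 w, a <= w <= t & (Q (upd x i s)).[w] = 0).
  have [[w h /eqP Qw]|H] := pselect (exists2 w, a <= w <= t & (Q (upd x i s)).[w] == 0).
    by right; exists w.
  by left => w h; apply/negP => Qw; apply: H; exists w.
  exists a; first by rewrite !inE eqxx.
  by rewrite -(c_horizontal Ds at_ noroot); near: s.
exists b; first by rewrite !inE eqxx orbT.
rewrite (c_horizontal Ds tb); first by near: s.
move=> w /andP[tw wb]; apply/negP => /eqP Qw.
have [h|h] := boxs.
  by have := h r1 (inbox _ ar1 (le_trans r1t tb)); rewrite Qr1 eqxx.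
have r1w : r1 < w.
  rewrite lt_neqAle (le_trans r1t tw) andbT; apply: contraNneq Qt => r1w.
  by have -> : t = r1; [apply/le_anti; rewrite r1t r1w tw | rewrite Qr1].
have [|z zr Qz] := @poly_rolle _ r1 w (Q (upd x i s)) r1w; first by rewrite Qr1 Qw.
have /andP[z1 z2] : r1 < z < w by rewrite in_itv in zr.
have := h z; rewrite Qz eqxx => /(_ _)/negP; apply=> //; apply: inbox.
  exact: le_trans ar1 (ltW z1).
exact: le_trans (ltW z2) wb.
Unshelve. all: by end_near. Qed.

(** Local covers are concatenated over [[- M, M]] by interval induction; beyond it nearby fibers
    have no roots, so [t] is joined to [M] or [- M]. *)
Lemma covered_all x i : i != n -> ev x n D != 0 -> exists L : seq R,
  (forall l, l \in L -> (Q x).[l] != 0) /\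
  \forall s \near x i, forall t, (Q (upd x i s)).[t] != 0 ->
    exists2 l, l \in L & c (upd (upd x i s) n t) = c (upd x n l).
Proof.
move=> ni Dx.
have [M M0 large] := near_no_large_root i (lead_q Dx).
have QM t : M <= `|t| -> (Q x).[t] != 0.
  by move=> Mt; have := nbhs_singleton large t Mt; rewrite upd_id.
have [L [QL covL]] : covered x i (- M) M.
  apply: interval_induction => [|u v w uv vw [L1 [Q1 cov1]] [L2 [Q2 cov2]]|t0 _].
  - by rewrite ge0_cp.
  - exists (L1 ++ L2); split=> [l|]; first by rewrite mem_cat => /orP[/Q1|/Q2].
    apply: filterS2 cov1 cov2 => s c1 c2 t /andP[ut tw] Qt.
    have [tv|vt] := leP t v.
      have [|l lL1 cl] := c1 t _ Qt; first by rewrite ut.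
      by exists l; rewrite // mem_cat lL1.
    have [|l lL2 cl] := c2 t _ Qt; first by rewrite ltW.
    by exists l; rewrite // mem_cat lL2 orbT.
  - by have [e e0 eP] := covered_local t0 ni Dx; exists e => // u v _ _; exact: eP.
exists (- M :: M :: L); split=> [l|].
  rewrite !inE => /or3P[/eqP->|/eqP->|/QL //]; apply: QM.
    by rewrite normrN ler_norm.
  by rewrite ler_norm.
have cvM : \forall s \near x i, c (upd (upd x i s) n M) = c (upd x n M).
  by apply: c_vertical => //; apply: QM; rewrite ler_norm.
have cvN : \forall s \near x i, c (upd (upd x i s) n (- M)) = c (upd x n (- M)).
  by apply: c_vertical => //; apply: QM; rewrite normrN ler_norm.
apply: filterS3 covL large (filterI (near_ev_neq0 i Dx) (filterI cvM cvN)).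
move=> s covs larges [Ds [cMs cNs]] t Qt.
have [tM|Mt] := leP M t.
  exists M; first by rewrite !inE eqxx orbT.
  rewrite -(c_horizontal Ds tM) // => w /andP[Mw _].
  by apply: larges; exact: le_trans (ler_norm _).
have [tM|Mt'] := leP t (- M).
  exists (- M); first by rewrite !inE eqxx.
  rewrite (c_horizontal Ds tM) // => w /andP[_ wM].
  by apply: larges; rewrite -normrN (le_trans _ (ler_norm _)) // lerNr.
have [|l lL cl] := covs t _ Qt; first by rewrite !ltW.
by exists l; rewrite // !inE lL !orbT.
Qed.

End Fiber.

(** * The set of values on a fiber, as a function of the base point *)

Section FiberValues.
Variables (R : realType) (T : Type) (n : nat).
Variables (c : (nat -> R) -> T) (D : mpol R n) (q : {poly mpol R n}).
Let Q x := map_poly (ev x n) q.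
Hypothesis c_dep : depends_on_first c n.+1.
Hypothesis c_loc :
  loc_cst_on c [set x | ev x n D != 0 /\ ev x n.+1 q != 0].
Hypothesis lead_q : forall x, ev x n D != 0 -> ev x n (lead_coef q) != 0.
Hypothesis simple_q : forall x t, ev x n D != 0 -> (Q x).[t] != 0 \/ (Q x)^`().[t] != 0.
Implicit Types (x y : nat -> R) (i : nat).

Definition fiber_values x : set T := [set c (upd x n t) | t in [set t | (Q x).[t] != 0]].

Lemma fiber_values_dep : depends_on_first fiber_values n.
Proof.
move=> x y exy; rewrite /fiber_values.
have -> : Q x = Q y by apply: eq_map_poly => a; exact: eq_ev.
suff -> : (fun t => c (upd x n t)) = (fun t => c (upd y n t)) by [].
apply/funext => t; apply: c_dep => k; rewrite ltnS leq_eqVlt /upd.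
by case: eqP => //= _; exact: exy.
Qed.

(** Nearby values occur at points of [L] by [covered_all]. Conversely [L] already yields all values
    over [x], and its finitely many points remain nonroots with unchanged values. *)
Lemma fiber_values_loc : loc_cst_on fiber_values [set x | ev x n D != 0].
Proof.
move=> x Dx i; have [ni|inn] := leqP n i.
  by apply: filterE => s; apply: fiber_values_dep => k; exact: upd_out.
have ni : i != n by rewrite ltn_eqF.
have [L [QL covL]] := covered_all c_dep c_loc lead_q simple_q ni Dx.
have LQ : \forall s \near x i, forall l : seq_sub L,
    (Q (upd x i s)).[val l] != 0 /\ c (upd (upd x i s) n (val l)) = c (upd x n (val l)).
  apply: (filter_forall (F := nbhs (x i))) => -[l /= lL].
  have Ql := QL _ lL; apply: filterI.
    have [e e0] := near_horner_neq0 i Ql.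
    by apply: filterS => s; apply; rewrite subrr normr0.
  exact: (c_vertical c_dep c_loc ni Dx Ql).
have covx := nbhs_singleton covL.
apply: filterS2 covL LQ => s covs Ls; apply/seteqP; split=> _ [t /= Qt <-].
  have [l lL ->] := covs t Qt; exists l => //; exact: QL.
have [] := covx t; first by rewrite upd_id.
rewrite upd_id => l lL ->; have [Ql cl] := Ls (SeqSub lL).
by exists l.
Qed.

Lemma finite_fiber_values x : ev x n D != 0 -> finite_set (fiber_values x).
Proof.
move=> Dx.
(* Any coordinate other than [n] would do: the cover is read at [s = x i], where nothing moves. *)
have ni : n.+1 != n by rewrite gtn_eqF.
have [L [_ covL]] := covered_all c_dep c_loc lead_q simple_q ni Dx.
apply: (@sub_finite_set _ _ ((fun l => c (upd x n l)) @` [set` L])).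
  move=> _ [t /= Qt <-]; have [] := nbhs_singleton covL t; first by rewrite upd_id.
  by rewrite upd_id => l lL ->; exists l.
exact: finite_image (finite_seq L).
Qed.

Lemma finite_image_fibers : finite_set (fiber_values @` [set x | ev x n D != 0]) ->
  finite_set (c @` [set x | ev x n D != 0 /\ ev x n.+1 q != 0]).
Proof.
move=> finF.
apply: (@sub_finite_set _ _
    (\bigcup_(X in fiber_values @` [set x | ev x n D != 0]) X)).
  move=> _ [x /= [Dx qx] <-]; exists (fiber_values x); first by exists x.
  by exists (x n); rewrite ?upd_id.
by apply: bigcup_finite => // _ [x Dx <-]; exact: finite_fiber_values.
Qed.

End FiberValues.

(** * Finiteness, by induction on the number of variables *)

Lemma mpol_char0 (R : realType) n k : k.+1%:R != 0 :> mpol R n.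
Proof.
apply/eqP => /(congr1 (ev (fun=> 0) n)); rewrite rmorph_nat rmorph0 => /eqP.
by rewrite pnatr_eq0.
Qed.

(** The codomain [T] varies in the induction, since the hypothesis is applied to the set-valued
    [fiber_values]. *)
Lemma finite_image_loc_cst (R : realType) n (p : mpol R n) (T : Type)
    (c : (nat -> R) -> T) :
    p != 0 -> depends_on_first c n -> loc_cst_on c [set x | ev x n p != 0] ->
  finite_set (c @` [set x | ev x n p != 0]).
Proof.
elim: n p T c => [|n IHn] p T c p0 c_dep c_loc.
  apply: (@sub_finite_set _ _ [set c (fun=> 0)]); last exact: finite_set1.
  by move=> _ [x _ <-]; exact: c_dep.
have [q [k [D0 [w [u [v [q0 D00 Ew Euv]]]]]]] :=
  separable_radical (@mpol_char0 R n) (p0 : (p : {poly mpol R n}) != 0).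
(* [D0] keeps the roots of [q] simple; the leading coefficient keeps them bounded. *)
pose D := D0 * lead_coef q.
have DE x : (ev x n D != 0) = (ev x n D0 != 0) && (ev x n (lead_coef q) != 0).
  by rewrite rmorphM mulf_eq0 negb_or.
have Dq_p x : ev x n D != 0 -> ev x n.+1 q != 0 -> ev x n.+1 p != 0.
  rewrite DE => /andP[Dx _] qx; apply: contraNneq Dx => px.
  have /(congr1 (ev x n.+1)) := Ew; rewrite rmorphM px mulr0 -mul_polyC rmorphM rmorphXn /= => /eqP.
  rewrite mulf_eq0 expf_eq0 -/(ev x n.+1 q) (negPf qx) andbF orbF.
  by rewrite map_polyC /= /horner_eval hornerC.
have simple_q x t : ev x n D != 0 ->
    (map_poly (ev x n) q).[t] != 0 \/ (map_poly (ev x n) q)^`().[t] != 0.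
  rewrite DE => /andP[Dx _].
  have [qt|] := eqVneq (map_poly (ev x n) q).[t] 0; last by left.
  have [dqt|] := eqVneq (map_poly (ev x n) q)^`().[t] 0; last by right.
  have /(congr1 (fun f => (map_poly (ev x n) f).[t])) := Euv.
  rewrite rmorphD !rmorphM /= -deriv_map hornerD !hornerM qt dqt !mulr0 addr0.
  by rewrite map_polyC hornerC => /esym Dx0; rewrite Dx0 eqxx in Dx.
have lead_q x : ev x n D != 0 -> ev x n (lead_coef q) != 0 by rewrite DE => /andP[].
have c_loc' : loc_cst_on c [set x | ev x n D != 0 /\ ev x n.+1 q != 0].
  by move=> x [Dx qx]; apply: c_loc; exact: Dq_p.
have D_neq0 : D != 0 by rewrite mulf_neq0 ?lead_coef_eq0.
(* No value is lost by shrinking the domain: each point moves off the zeros of [D%:P * q] with [c]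
   unchanged. *)
apply: (@sub_finite_set _ _ (c @` [set x | ev x n D != 0 /\ ev x n.+1 q != 0])).
  move=> _ [x /= px <-].
  have [||y [_ Dqy <-]] := @loc_cst_nonroot _ _ c _ n.+1 (D%:P * q) x c_loc _ _ px.
  - by move=> y py i; exact: near_ev_neq0.
  - by rewrite mulf_neq0 ?polyC_eq0.
  exists y => //=; move: Dqy; rewrite rmorphM mulf_eq0 negb_or => /andP[Dy qy].
  by split=> //; move: Dy; rewrite evS map_polyC hornerC.
apply: finite_image_fibers => //; apply: IHn => //.
- exact: fiber_values_dep.
- exact: fiber_values_loc.
Qed.

(** * Strong shift equivalence, and conjugation by matrices near the identity *)

Section SSETheory.
Variable R : realType.
Implicit Types A B C : sqmx R.

Lemma ESSE_sym A B : ESSE A B -> ESSE B A.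
Proof. by move=> [U [V [U0 V0 AUV BVU]]]; exists V, U. Qed.

Lemma SSE_sym A B : SSE A B -> SSE B A.
Proof.
move=> [l [C [C0 Cl nnC eC]]]; exists l, (fun i => C (l - i)%N); split.
- by rewrite subn0.
- by rewrite subnn.
- by move=> i _; apply: nnC; exact: leq_subr.
- by move=> i il; apply: ESSE_sym; rewrite -(subnSK il); apply: eC; rewrite subnSK // leq_subr.
Qed.

Lemma SSE_trans A B C : SSE A B -> SSE B C -> SSE A C.
Proof.
move=> [l [F [F0 Fl nnF eF]]] [m [G [G0 Gm nnG eG]]].
exists (l + m)%N, (fun i => if (i <= l)%N then F i else G (i - l)%N); split => //.
- have [lm|_] := leqP (l + m) l; last by rewrite addKn.
  have m0 : m = 0%N by move: lm; rewrite -[X in (_ <= X)%N]addn0 leq_add2l leqn0 => /eqP.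
  by rewrite m0 addn0 Fl -G0 -Gm m0.
- move=> i ilm; have [/nnF //|li] := leqP i l.
  by apply: nnG; rewrite leq_subLR.
- move=> i ilm; have [il|li|il] := ltngtP i l.
  + exact: eF.
  + by rewrite subSn ?(ltnW li) //; apply: eG; rewrite ltn_subLR // ltnW.
  + rewrite il Fl subSn // subnn -G0; apply: eG.
    by move: ilm; rewrite il -{1}[l]addn0 ltn_add2l.
Qed.

Lemma SSE_class_eq A B : SSE A B -> SSE_class A = SSE_class B.
Proof.
move=> AB; apply/seteqP; split=> C; first exact: SSE_trans (SSE_sym AB).
exact: SSE_trans AB.
Qed.

Lemma ESSE_SSE A B : nonneg_sqmx A -> nonneg_sqmx B -> ESSE A B -> SSE A B.
Proof.
move=> A0 B0 AB; exists 1%N, (fun i => if i is 0%N then A else B); split=> //.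
  by case.
by case.
Qed.

Local Notation sq B := (Tagged (fun k => 'M[R]_k.+1) B : sqmx R).

Lemma nonneg_mulmx m n p (U : 'M[R]_(m, n)) (V : 'M[R]_(n, p)) :
  nonneg_mx U -> nonneg_mx V -> nonneg_mx (U *m V).
Proof.
move=> /mxOverP U0 /mxOverP V0; apply/mxOverP => i j; rewrite nnegrE mxE.
by rewrite sumr_ge0 // => k _; rewrite mulr_ge0 // -nnegrE.
Qed.

(* [W] is the inverse of [U], and the intermediate matrix is
   [W B U = (W B H) V]. *)
Lemma SSE_conj m (B B' H U V W : 'M[R]_m.+1) :
    nonneg_mx U -> nonneg_mx V -> nonneg_mx (W *m B) -> nonneg_mx (W *m B *m H) ->
    U *m W = 1%:M -> H *m V = U -> H *m B' = B *m H ->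
  SSE (sq B) (sq B').
Proof.
move=> U0 V0 X0 Y0 UW HV HB'.
have BE : B = U *m (W *m B) by rewrite mulmxA UW mul1mx.
have CE : W *m B *m U = W *m B *m H *m V by rewrite -HV !mulmxA.
(* For square matrices the right inverse [V *m W] of [H] is also a left inverse. *)
have VWH : V *m W *m H = 1%:M by apply: mulmx1C; rewrite mulmxA HV.
have B'E : B' = V *m (W *m B *m H) by rewrite -mulmxA -HB' !mulmxA VWH mul1mx.
have nnB : nonneg_mx B by rewrite BE; exact: nonneg_mulmx.
have nnB' : nonneg_mx B' by rewrite B'E; exact: nonneg_mulmx.
have nnC : nonneg_mx (W *m B *m U) by exact: nonneg_mulmx.
apply: (@SSE_trans _ (sq (W *m B *m U))); apply: ESSE_SSE => //.
  by exists U, (W *m B).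
by exists (W *m B *m H), V.
Qed.

Lemma near_SSE_rank1 m (B : 'M[R]_m.+1) (g : 'cV[R]_m.+1) (j : 'I_m.+1) :
  pos_mx B -> \forall s \near (0 : R), forall B' : 'M[R]_m.+1,
    (1%:M + (s *: g) *m delta_mx 0 j) *m B' = B *m (1%:M + (s *: g) *m delta_mx 0 j) ->
  SSE (sq B) (sq B').
Proof.
move=> /mxOverP B0.
(* Off row [j], [w] and [v] are the positive and negative parts of [s * g]. In row [j], [v]
   vanishes, so that [H *m V = U] has no quadratic term. *)
pose w s k : R := if k == j then s * g k 0 else (`|s * g k 0| + s * g k 0) / 2.
pose v s k : R := if k == j then 0 else (`|s * g k 0| - s * g k 0) / 2.
(* The entries of [U^-1 B], which tend to those of [B]. *)
pose X s k l := B k l - (1 + w s j)^-1 * (w s k * B j l).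
have FF := nbhs_filter (0 : R).
have cs k : (fun s => s * g k 0) @ (0 : R) --> (0 : R).
  by rewrite -[X in _ --> X](mul0r (g k 0)); apply: cvgM; [exact: cvg_id|exact: cvg_cst].
have cw k : (fun s => w s k) @ (0 : R) --> (0 : R).
  rewrite /w; case: (k == j); first exact: cs.
  have E : (`|0 : R| + 0) / 2 = 0 :> R by rewrite normr0 addr0 mul0r.
  rewrite -[X in _ --> X]E.
  by apply: cvgM; [apply: cvgD; [apply: cvg_norm; exact: cs|exact: cs]|exact: cvg_cst].
have cX k l : (fun s => X s k l) @ (0 : R) --> B k l.
  have -> : B k l = B k l - (1 + 0)^-1 * (0 * B j l) by rewrite mul0r mulr0 subr0.
  apply: cvgB; first exact: cvg_cst.
  apply: cvgM; last by apply: cvgM; [exact: cw|exact: cvg_cst].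
  by apply: cvgV; [rewrite addr0 oner_neq0|apply: cvgD; [exact: cvg_cst|exact: cw]].
have nX : \forall s \near (0 : R), forall kl : 'I_m.+1 * 'I_m.+1, 0 < X s kl.1 kl.2.
  apply: (filter_forall (F := nbhs (0 : R))) => -[k l] /=.
  by apply: (@cvgr_gt _ _ _ FF _ (B k l)); [exact: cX|rewrite -posrE].
(* Column [j] of [U^-1 B H]; the other columns agree with [U^-1 B]. *)
have nY : \forall s \near (0 : R), forall k,
    0 < X s k j + s * \sum_l X s k l * g l 0.
  apply: (filter_forall (F := nbhs (0 : R))) => k.
  apply: (@cvgr_gt _ _ _ FF _ (B k j + 0 * \sum_l B k l * g l 0)).
    apply: cvgD; first exact: cX.
    apply: cvgM; first exact: cvg_id.
    apply: cvg_big => [|l _]; first exact: add_continuous.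
    by apply: cvgM; [exact: cX|exact: cvg_cst].
  by rewrite mul0r addr0 -posrE.
have nw : \forall s \near (0 : R), 0 < 1 + w s j.
  apply: (@cvgr_gt _ _ _ FF _ (1 + 0)); last by rewrite addr0.
  by apply: cvgD; [exact: cvg_cst|exact: cw].
apply: filterS3 nX nY nw => s nX nY nw B' HB'.
pose r : 'rV[R]_m.+1 := delta_mx 0 j.
pose wm : 'cV[R]_m.+1 := \col_k w s k.
pose vm : 'cV[R]_m.+1 := \col_k v s k.
have colr (y : 'cV[R]_m.+1) k l : (y *m r) k l = y k 0 * (l == j)%:R.
  by rewrite mxE big_ord1 mxE eqxx.
have rcol (y : 'cV[R]_m.+1) : r *m y = (y j 0)%:M.
  by rewrite -rowE; apply/matrixP => a b; rewrite !ord1 !mxE eqxx.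
(* The Sherman-Morrison formula for the inverse of [U]. *)
pose W := 1%:M - (1 + w s j)^-1 *: (wm *m r).
have WB k l : (W *m B) k l = X s k l.
  rewrite mulmxBl mul1mx -scalemxAl -mulmxA -rowE !mxE big_ord1 !mxE /X.
  by rewrite mulrA.
apply: (@SSE_conj m B B' (1%:M + (s *: g) *m r) (1%:M + wm *m r) (1%:M + vm *m r) W) => //.
- apply/mxOverP => k l; rewrite nnegrE mxE [X in X + _]mxE colr mxE.
  rewrite /w; have [->|_] := eqVneq k j; last first.
    rewrite addr_ge0 ?mulr_ge0 ?invr_ge0 ?ler0n //.
    by rewrite -lerBlDr sub0r -normrN ler_norm.
  have := ltW nw; rewrite /w eqxx (eq_sym l).
  by case: (j == l); rewrite ?mulr1 // mulr0 addr0.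
- apply/mxOverP => k l; rewrite nnegrE mxE [X in X + _]mxE colr mxE.
  rewrite addr_ge0 ?mulr_ge0 ?ler0n // /v; have [//|_] := eqVneq k j.
  by rewrite mulr_ge0 ?invr_ge0 ?ler0n // subr_ge0 ler_norm.
- by apply/mxOverP => k l; rewrite nnegrE WB ltW // (nX (k, l)).
- apply/mxOverP => k l; rewrite nnegrE mulmxDr mulmx1 mulmxA mxE WB colr.
  have [->|_] := eqVneq l j; last by rewrite mulr0 addr0 ltW // (nX (k, l)).
  have := ltW (nY k); rewrite mulr1 mxE mulr_sumr.
  congr (0 <= _ + _); apply: eq_bigr => l' _.
  by rewrite WB [in RHS]mxE mulrCA.
- rewrite /W mulmxBr mulmx1 mulmxDl mul1mx -scalemxAr mulmxA -(mulmxA wm) rcol mxE.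
  rewrite mul_mx_scalar -scalemxAl -scalerDr -[X in _ *: (X + _)]scale1r -scalerDl.
  rewrite scalerA mulVf ?gt_eqF //.
  by rewrite scale1r addrK.
- rewrite mulmxDr mulmx1 mulmxDl mul1mx mulmxA -(mulmxA (s *: g)) rcol mxE.
  rewrite /v eqxx mul_mx_scalar scale0r mul0mx addr0 -addrA -mulmxDl; congr (_ + _ *m _).
  apply/matrixP => k l; rewrite !mxE ord1 /v /w.
  by case: eqP => [->|_]; [rewrite addr0 | field].
Qed.

End SSETheory.

(** * The positive conjugates of a matrix and their classes *)

Section ConjugacyClass.
Variables (R : realType) (n : nat) (A : 'M[R]_n.+1).
Local Notation N := (n.+1 * n.+1)%N.
Local Notation sq B := (Tagged (fun k => 'M[R]_k.+1) B : sqmx R).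
Implicit Types x : nat -> R.

Definition mx_of x : 'M[R]_n.+1 := \matrix_(i, j) x (mxvec_index i j).

Definition conj_of x : 'M[R]_n.+1 := invmx (mx_of x) *m A *m mx_of x.

Let X : 'M[mpol R N]_n.+1 := \matrix_(i, j) mvar R N (mxvec_index i j).
(** A polynomial form of the conjugate: the extra determinant makes the scaling factor a square, so
    signs of entries are kept. *)
Let Z : 'M[mpol R N]_n.+1 := \det X *: (\adj X *m map_mx (mcst N) A *m X).
Let P : mpol R N := \det X * \prod_ij Z ij.1 ij.2.

Let ev_X x : map_mx (ev x N) X = mx_of x.
Proof. by apply/matrixP => i j; rewrite !mxE ev_mvar. Qed.

Let ev_detX x : ev x N (\det X) = \det (mx_of x).
Proof. by rewrite -det_map_mx ev_X. Qed.

Let ev_Z x i j : mx_of x \in unitmx ->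
  ev x N (Z i j) = (\det (mx_of x)) ^+ 2 * conj_of x i j.
Proof.
move=> Gu; have -> : ev x N (Z i j) = map_mx (ev x N) Z i j by rewrite [RHS]mxE.
rewrite map_mxZ !map_mxM map_mx_adj ev_X ev_detX.
have -> : map_mx (ev x N) (map_mx (mcst N) A) = A.
  by apply/matrixP => a b; rewrite !mxE ev_mcst.
have -> : \adj (mx_of x) = \det (mx_of x) *: invmx (mx_of x).
  by rewrite /invmx Gu scalerA divrr // scale1r.
by rewrite -!scalemxAl scalerA mxE.
Qed.

Definition pos_conj x : bool :=
  (mx_of x \in unitmx) && [forall ij, 0 < conj_of x ij.1 ij.2].

Lemma pos_conjP x : reflect (mx_of x \in unitmx /\ pos_mx (conj_of x)) (pos_conj x).
Proof.
apply: (iffP andP) => -[-> h]; split => //.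
  by apply/mxOverP => i j; rewrite posrE; have /forallP /(_ (i, j)) := h.
by apply/forallP => -[i j] /=; rewrite -posrE; apply: (mxOverP h).
Qed.

Let evP x : (ev x N P != 0) =
  (mx_of x \in unitmx) && [forall ij, conj_of x ij.1 ij.2 != 0].
Proof.
rewrite rmorphM mulf_eq0 negb_or ev_detX -unitfE; apply: andb_id2l => Gu.
have d0 : \det (mx_of x) != 0 by rewrite -unitfE.
rewrite rmorph_prod prodf_seq_neq0; apply/allP/forallP => h ij.
  have := h ij; rewrite mem_index_enum ev_Z // mulf_eq0 negb_or => /(_ isT) /=.
  by case/andP.
by rewrite ev_Z // mulf_neq0 // expf_neq0.
Qed.

(** The default [set0] extends the class to all conjugators, since the positivity region need not be
    the full complement of a hypersurface. *)
Definition conj_class x : set (sqmx R) :=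
  if pos_conj x then SSE_class (sq (conj_of x)) else set0.

Lemma mx_of_dep : depends_on_first mx_of N.
Proof. by move=> x y exy; apply/matrixP => i j; rewrite !mxE exy. Qed.

Lemma conj_class_dep : depends_on_first conj_class N.
Proof. by move=> x y exy; rewrite /conj_class /pos_conj /conj_of (mx_of_dep exy). Qed.

Lemma mx_of_upd x i j t : 
  mx_of (upd x (mxvec_index i j) t) = mx_of x + (t - x (mxvec_index i j)) *: delta_mx i j.
Proof.
apply/matrixP => a b; rewrite !mxE /upd.
have -> : (mxvec_index a b == mxvec_index i j :> nat) = (a == i) && (b == j).
  by rewrite (inj_eq val_inj) (inj_eq (@cast_ord_inj _ _ _)) (inj_eq enum_rank_inj) xpair_eqE.
case: andP => [[/eqP-> /eqP->]|_]; first by rewrite mulr1 addrC subrK.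
by rewrite mulr0 addr0.
Qed.

(** Where [P] is nonzero no entry of [Z] vanishes, so by continuity none changes sign nearby. *)
Lemma near_pos_conj x k : ev x N P != 0 ->
  \forall t \near x k, pos_conj (upd x k t) = pos_conj x.
Proof.
move=> Px; have := Px; rewrite evP => /andP[Gu /forallP Bn0].
have FF := nbhs_filter (x k).
have unit_near : \forall t \near x k, mx_of (upd x k t) \in unitmx.
  by apply: filterS (near_ev_neq0 k Px) => t; rewrite evP => /andP[].
have sign_gt0 y i j : mx_of y \in unitmx -> (0 < ev y N (Z i j)) = (0 < conj_of y i j).
  by move=> yu; rewrite ev_Z // pmulr_rgt0 // exprn_even_gt0 //= -unitfE.
have sign_near : \forall t \near x k, forall ij : 'I_n.+1 * 'I_n.+1,
    (0 < ev (upd x k t) N (Z ij.1 ij.2)) = (0 < ev x N (Z ij.1 ij.2)).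
  apply: (filter_forall (F := nbhs (x k))) => -[i j] /=.
  have cZ := @continuous_ev_upd R x k N (Z i j).
  have : ev x N (Z i j) != 0.
    by rewrite ev_Z // mulf_neq0 ?(Bn0 (i, j)) // expf_neq0 // -unitfE.
  rewrite neq_lt => /orP[Zlt|Zgt].
    rewrite (lt_gtF Zlt); have := @cvgr_lt _ _ _ FF _ _ cZ _ Zlt.
    by apply: filterS => t /lt_gtF.
  by rewrite Zgt; exact: (@cvgr_gt _ _ _ FF _ _ cZ _ Zgt).
apply: filterS2 unit_near sign_near => t tu ts; rewrite /pos_conj Gu tu /=.
by apply/forallP/forallP => h ij; move: (h ij); rewrite -!sign_gt0 // ts.
Qed.

Lemma conj_class_loc : loc_cst_on conj_class [set x | ev x N P != 0].
Proof.
move=> x /= Px k; have [Nk|kN] := leqP N k.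
  by apply: filterE => s; apply: conj_class_dep => l; exact: upd_out.
have [i [j Ek]] : exists i j : 'I_n.+1, k = mxvec_index i j.
  rewrite -[k]/(nat_of_ord (Ordinal kN)).
  by case/mxvec_indexP: (Ordinal kN) => i j; exists i, j.
have := near_pos_conj k Px; rewrite /conj_class.
case: (pos_conjP x) => [[Gu Bpos]|_] npc; last first.
  by apply: filterS npc => t ->.
have shift0 : (fun t => t - x k) @ x k --> (0 : R).
  rewrite -[X in _ --> X](subrr (x k)).
  by apply: cvgB; [exact: cvg_id|exact: cvg_cst].
(* Adding [d] to entry [(i, j)] of [G] gives [G (I + d g e_j^T)] with [g = G^-1 e_i]. *)
pose g : 'cV_n.+1 := col i (invmx (mx_of x)).
pose H t : 'M_n.+1 := 1%:M + ((t - x k) *: g) *m delta_mx 0 j.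
have nSSE : \forall t \near x k, forall B' : 'M_n.+1,
    H t *m B' = conj_of x *m H t -> SSE (sq (conj_of x)) (sq B').
  exact: (shift0 _ (near_SSE_rank1 g j Bpos)).
apply: filterS2 nSSE npc => t tSSE Ept; rewrite Ept; move: (Ept) => /pos_conjP[tu _].
apply/esym/SSE_class_eq/tSSE.
have GH : mx_of (upd x k t) = mx_of x *m H t.
  rewrite {1}Ek mx_of_upd -Ek /H mulmxDr mulmx1 -scalemxAl -scalemxAr.
  by rewrite mulmxA /g colE mulmxA mulmxV // mul1mx mul_delta_mx.
have -> : H t = invmx (mx_of x) *m mx_of (upd x k t) by rewrite GH mulKmx.
by rewrite /conj_of !mulmxA !mulmxK.
Qed.

Lemma pos_conj_point (B : 'M[R]_n.+1) : pos_mx B -> similar_in unitmx A B ->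
  exists2 x, ev x N P != 0 & conj_class x = SSE_class (sq B).
Proof.
move=> Bpos [Q Qu /(similarRL Qu) BE].
(* Similarity reads [B = Q A Q^-1], so the conjugator is [Q^-1]; its entries are padded by zeros to
   a sequence. *)
pose x k := if insub k is Some l then mxvec (invmx Q) 0 l else 0.
have GE : mx_of x = invmx Q.
  by apply/matrixP => i j; rewrite mxE /x valK mxvecE.
have cE : conj_of x = B by rewrite /conj_of GE invmxK BE.
have Gu : mx_of x \in unitmx by rewrite GE unitmx_inv.
have pc : pos_conj x by apply/pos_conjP; rewrite cE.
exists x; last by rewrite /conj_class pc cE.
rewrite evP Gu; apply/forallP => -[i j]; rewrite cE gt_eqF // -posrE.
exact: (mxOverP Bpos).
Qed.

Lemma finite_pos_conj_classes :
  finite_set [set SSE_class (sq B) | B in [set B | pos_mx B /\ similar_in unitmx A B]].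
Proof.
have [P0|P0] := eqVneq P 0.
  (* If [P] is the zero polynomial there is no positive conjugate, as one would give a point where
     [P] is nonzero. *)
  rewrite (_ : image _ _ = set0) //; apply/seteqP; split=> // cl [B [Bpos AB] _].
  by have [x] := pos_conj_point Bpos AB; rewrite P0 rmorph0 eqxx.
apply: sub_finite_set (finite_image_loc_cst P0 conj_class_dep conj_class_loc).
move=> _ [B [Bpos AB] <-]; have [x Px <-] := pos_conj_point Bpos AB.
by exists x.
Qed.

End ConjugacyClass.

Theorem theorem5p6 (R : realType) (n : nat) (A : 'M[R]_n.+1)
    (A_primitive : primitive_mx A) (trA_gt0 : 0 < \tr A) :
  finite_set
    [set SSE_class (Tagged (fun k => 'M[R]_k.+1) B)
       | B in [set B : 'M[R]_n.+1 | pos_mx B /\ similar_in unitmx A B]].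
Proof. exact: finite_pos_conj_classes. Qed.
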